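(* Let $K$ be a field. For every integer $n\geq 1$, let $S_n=K[x_1,\ldots,x_n,y]$ and let $I_n=(x_1y,x_2y,\ldots,x_ny)\subset S_n$. For any real number $\varepsilon$ with $0<\varepsilon<\frac{1}{2}$, define the positive integer $A=A(\varepsilon)$ by $$A= \left\lceil \frac{3B+6}{8\varepsilon}-\frac{B+1}{2} \right\rceil, \quad\text{where } B=\log\left( \frac{2\varepsilon +1}{4\varepsilon}\right).$$ Then $$\operatorname{hdepth}(S_n/I_n)\leq \left\lceil \frac{n}{2} \right\rceil + \left\lfloor \varepsilon n \right\rfloor + A - 2\quad\text{for all integers } n\geq 2.$$
   Context: Let $S$ be a polynomial ring in finitely many variables over a field $K$, with the standard grading (each variable has degree $1$), and let $M$ be a finitely generated graded $S$-module. The Hilbert depth of $M$, denoted $\operatorname{hdepth}(M)$, is the maximal depth of a finitely generated graded $S$-module $N$ with the same Hilbert series as $M$. The ideal $I_n$ is the edge ideal of the star graph with vertex set $\{x_1,\ldots,x_n,y\}$ and edges $\{x_i,y\}$, $1\leq i\leq n$. $\lceil\cdot\rceil$ and $\lfloor\cdot\rfloor$ denote the ceiling and floor functions, and $\log$ is the natural logarithm. *)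

(* Defs.v *)
From HB Require Import structures.
From mathcomp Require Import all_boot all_order all_algebra.
From mathcomp Require Import generic_quotient ring_quotient.
From mathcomp Require Import boolp classical_sets reals exp.
From mathcomp Require Import mpoly lra.

Set Implicit Arguments.
Unset Strict Implicit.
Unset Printing Implicit Defensive.

Import Order.TTheory GRing.Theory Num.Theory.

Local Open Scope ring_scope.
Local Open Scope quotient_scope.

Section GeneratedSubmodule.
Variables (R : comNzRingType) (V : lmodType R).

Definition span_of (s : seq V) : {pred V} :=
  [pred v | `[< exists c : 'I_(size s) -> R, v = \sum_(j < size s) c j *: s`_j >]].

Lemma span_of_submod_closed (s : seq V) : submod_closed (span_of s).
Proof.
split=> [|a u v].
  by apply/asboolP; exists (fun=> 0); rewrite big1 // => j _; rewrite scale0r.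
move=> /asboolP[c ->] /asboolP[d ->]; apply/asboolP.
exists (fun j => a * c j + d j); rewrite scaler_sumr -big_split /=.
by apply: eq_bigr => j _; rewrite scalerDl scalerA.
Qed.

HB.instance Definition _ (s : seq V) :=
  GRing.isSubmodClosed.Build R V (span_of s) (span_of_submod_closed s).

Definition finitely_generated : Prop :=
  exists s : seq V, forall v : V, v \in span_of s.

(* v \in (f_1, ..., f_r) V *)
Definition in_ideal_mul (f : seq R) (v : V) : Prop :=
  exists w : 'I_(size f) -> V, v = \sum_(j < size f) f`_j *: w j.

Definition regular_sequence (f : seq R) : Prop :=
  (forall i : nat, (i < size f)%N -> forall v : V,
     in_ideal_mul (take i f) (f`_i *: v) -> in_ideal_mul (take i f) v)
  /\ (exists v : V, ~ in_ideal_mul f v).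

End GeneratedSubmodule.

Section QuotientModule.
Variables (R : nzRingType) (V : lmodType R) (U : submodClosed V).

(* A submodule is closed under opposites, but submodClosed does not inherit from
   zmodClosed, which Quotient.quot requires. *)
Definition submod_pred : {pred V} := U.

Lemma submod_pred_zmod_closed : zmod_closed submod_pred.
Proof.
split=> [|u v Uu Uv]; first exact: (rpred0 U).
by rewrite -scaleN1r; apply: (rpredD Uu); exact: (rpredZ (s := U)).
Qed.

HB.instance Definition _ :=
  GRing.isZmodClosed.Build V submod_pred submod_pred_zmod_closed.

Definition quot_mod : Type := Quotient.quot submod_pred.

HB.instance Definition _ := GRing.Zmodule.on quot_mod.

Definition quot_proj (v : V) : quot_mod := \pi_(Quotient.quot submod_pred) v.

Lemma quot_projB : {morph quot_proj : u v / u - v}.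
Proof. by move=> u v; rewrite /quot_proj raddfB. Qed.

Lemma quot_projD : {morph quot_proj : u v / u + v}.
Proof. by move=> u v; rewrite /quot_proj raddfD. Qed.

Lemma quot_proj0 : quot_proj 0 = 0.
Proof. by rewrite /quot_proj raddf0. Qed.

Lemma quot_proj_eq0 (v : V) : quot_proj v = 0 <-> v \in U.
Proof.
have E := Quotient.idealrBE submod_pred v 0; rewrite subr0 in E.
rewrite -quot_proj0 /quot_proj; split=> [|vU]; last by apply/eqP; rewrite -E.
by move/eqP; rewrite -E.
Qed.

Lemma quot_proj_surj (x : quot_mod) : exists v, x = quot_proj v.
Proof. by exists (repr x); rewrite /quot_proj reprK. Qed.

Definition quot_scale (a : R) (x : quot_mod) : quot_mod := quot_proj (a *: repr x).

Lemma quot_scaleE a v : quot_scale a (quot_proj v) = quot_proj (a *: v).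
Proof.
apply/eqP; rewrite -subr_eq0 -quot_projB -scalerBr; apply/eqP/quot_proj_eq0.
by apply: rpredZ; apply/quot_proj_eq0; rewrite quot_projB /quot_proj reprK subrr.
Qed.

Lemma quot_scaleA a b x : quot_scale a (quot_scale b x) = quot_scale (a * b) x.
Proof. by have [v ->] := quot_proj_surj x; rewrite !quot_scaleE scalerA. Qed.

Lemma quot_scale1 : left_id 1 quot_scale.
Proof. by move=> x; have [v ->] := quot_proj_surj x; rewrite quot_scaleE scale1r. Qed.

Lemma quot_scaleDr : right_distributive quot_scale +%R.
Proof.
move=> a x y; have [u ->] := quot_proj_surj x; have [v ->] := quot_proj_surj y.
by rewrite -quot_projD !quot_scaleE scalerDr quot_projD.
Qed.

Lemma quot_scaleDl x : {morph quot_scale^~ x : a b / a + b}.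
Proof.
move=> a b; have [u ->] := quot_proj_surj x.
by rewrite !quot_scaleE scalerDl quot_projD.
Qed.

HB.instance Definition _ := GRing.Zmodule_isLmodule.Build R quot_mod
  quot_scaleA quot_scale1 quot_scaleDr quot_scaleDl.

End QuotientModule.

(* Z-graded modules over K[X_0, ..., X_(m-1)] with its standard grading: the
   module is the internal direct sum of the additive subgroups gpiece i. *)
Record gradedModule (K : fieldType) (m : nat) := GradedModule {
  gcarrier :> lmodType {mpoly K[m]};
  gpiece : int -> set gcarrier;
  gpiece0 : forall i, gpiece i 0;
  gpieceB : forall i u v, gpiece i u -> gpiece i v -> gpiece i (u - v);
  gpieceZ : forall (d : nat) (i : int) (p : {mpoly K[m]}) v,
    p \is d.-homog -> gpiece i v -> gpiece (d%:Z + i) (p *: v);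
  gpiece_sum : forall v, exists (s : seq int) (c : int -> gcarrier),
    [/\ uniq s, forall i, gpiece i (c i) & v = \sum_(i <- s) c i];
  gpiece_direct : forall (s : seq int) (c : int -> gcarrier),
    uniq s -> (forall i, gpiece i (c i)) -> \sum_(i <- s) c i = 0 ->
    forall i, i \in s -> c i = 0
}.

Section HilbertDepth.
Variables (K : fieldType) (m : nat).
Implicit Types M N : gradedModule K m.

(* K acts on M through the constant polynomials. *)
Definition has_dim M (P : set M) (k : nat) : Prop :=
  exists b : 'I_k -> M,
  [/\ forall j, P (b j),
      forall v, P v -> exists c : 'I_k -> K, v = \sum_(j < k) (c j)%:MP *: b j
    & forall c : 'I_k -> K, \sum_(j < k) (c j)%:MP *: b j = 0 -> forall j, c j = 0].

(* i |-> dim_K M_i, i.e. the coefficients of the Hilbert series of M; the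
   default value 0 is not used when M is finitely generated. *)
Definition hilbert_function M (i : int) : nat :=
  xget 0%N [set k | has_dim (gpiece (g := M) i) k].

Definition same_hilbert_series M N : Prop :=
  hilbert_function M =1 hilbert_function N.

Definition irrelevant_ideal : {pred {mpoly K[m]}^o} :=
  span_of [seq ('X_i : {mpoly K[m]}^o) | i : 'I_m].

(* For M = 0 there is no regular sequence, hence no depth. *)
Definition is_depth M (d : nat) : Prop :=
  (exists f : seq {mpoly K[m]},
     [/\ size f = d, {subset f <= irrelevant_ideal} & regular_sequence M f])
  /\ (forall f : seq {mpoly K[m]},
     {subset f <= irrelevant_ideal} -> regular_sequence M f -> (size f <= d)%N).

Definition is_hdepth M (h : nat) : Prop :=
  (exists N, [/\ finitely_generated N, same_hilbert_series N M & is_depth N h])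
  /\ (forall N d, finitely_generated N -> same_hilbert_series N M ->
        is_depth N d -> (d <= h)%N).

End HilbertDepth.

Section GradedQuotient.
Variables (K : fieldType) (m : nat).

Definition homogeneous_submod (M : gradedModule K m) (U : {pred M}) : Prop :=
  forall (s : seq int) (c : int -> M), uniq s -> (forall i, gpiece i (c i)) ->
    \sum_(i <- s) c i \in U -> forall i, i \in s -> c i \in U.

Variables (M : gradedModule K m) (U : submodClosed M).
Hypothesis homU : homogeneous_submod U.

Definition quot_piece (i : int) : set (quot_mod U) :=
  [set quot_proj U v | v in gpiece (g := M) i].

Lemma quot_proj_sum (s : seq int) (c : int -> M) :
  quot_proj U (\sum_(i <- s) c i) = \sum_(i <- s) quot_proj U (c i).
Proof. exact: (big_morph _ (@quot_projD _ _ U) (@quot_proj0 _ _ U)). Qed.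

Lemma quot_piece0 i : quot_piece i 0.
Proof. by exists 0; [exact: gpiece0 | exact: quot_proj0]. Qed.

Lemma quot_pieceB i x y : quot_piece i x -> quot_piece i y -> quot_piece i (x - y).
Proof.
move=> [u Pu <-] [v Pv <-]; exists (u - v); first exact: gpieceB.
exact: quot_projB.
Qed.

Lemma quot_pieceZ (d : nat) (i : int) (p : {mpoly K[m]}) (x : quot_mod U) :
  p \is d.-homog -> quot_piece i x -> quot_piece (d%:Z + i) (p *: x).
Proof.
move=> hp [v Pv <-]; exists (p *: v); first exact: gpieceZ.
by rewrite -quot_scaleE.
Qed.

Lemma quot_piece_sum (x : quot_mod U) : exists (s : seq int) (c : int -> quot_mod U),
  [/\ uniq s, forall i, quot_piece i (c i) & x = \sum_(i <- s) c i].
Proof.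
have [v ->] := quot_proj_surj x; have [s [c [us Pc ->]]] := gpiece_sum v.
exists s, (fun i => quot_proj U (c i)); split=> //; last exact: quot_proj_sum.
by move=> i; exists (c i).
Qed.

Lemma quot_piece_direct (s : seq int) (c : int -> quot_mod U) :
  uniq s -> (forall i, quot_piece i (c i)) -> \sum_(i <- s) c i = 0 ->
  forall i, i \in s -> c i = 0.
Proof.
move=> us Pc.
have /choice[e eP] i : exists v, gpiece i v /\ quot_proj U v = c i.
  by have [v ? ?] := Pc i; exists v.
have -> : c = fun i => quot_proj U (e i) by apply/funext => i; case: (eP i).
rewrite -quot_proj_sum => /quot_proj_eq0 sU i si; apply/quot_proj_eq0.
by apply: homU si => // j; case: (eP j).
Qed.

Definition graded_quotient : gradedModule K m :=
  GradedModule quot_piece0 quot_pieceB quot_pieceZ quot_piece_sum quot_piece_direct.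

End GradedQuotient.

Section PolynomialRing.
Variables (K : fieldType) (m : nat).
Local Notation S := {mpoly K[m]}.

Definition poly_piece (i : int) : set S^o :=
  [set p : S^o | if i is Posz d then (p : S) \is d.-homog else p == 0].

Lemma poly_piece0 i : poly_piece i 0.
Proof. by case: i => d /=; [exact: rpred0 | exact: eqxx]. Qed.

Lemma poly_pieceB i u v : poly_piece i u -> poly_piece i v -> poly_piece i (u - v).
Proof.
case: i => d /=; first exact: rpredB.
by move=> /eqP-> /eqP->; rewrite subrr.
Qed.

Lemma poly_pieceZ (d : nat) (i : int) (p : S) (v : S^o) :
  p \is d.-homog -> poly_piece i v -> poly_piece (d%:Z + i) (p *: v).
Proof.
case: i => e hp; first exact: dhomogM.
by move=> /eqP->; rewrite scaler0; exact: poly_piece0.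
Qed.

Lemma pihomog_poly_piece (k : nat) (i : int) (p : S) :
  poly_piece i p -> pihomog mdeg k p = if i == k%:Z then p else 0.
Proof.
case: i => d; last by move=> /eqP->; rewrite pihomog0.
move=> hp; have [dk|ne] := eqVneq (Posz d) k%:Z.
  by case: dk hp => -> hp; exact: pihomog_dE.
exact: pihomog_ne0 ne hp.
Qed.

Lemma pihomog_piece_sum (k : nat) (s : seq int) (c : int -> S^o) :
  uniq s -> (forall i, poly_piece i (c i)) ->
  pihomog mdeg k (\sum_(i <- s) c i : S) = if k%:Z \in s then c k%:Z else 0.
Proof.
move=> us Pc; rewrite raddf_sum /=.
rewrite (eq_bigr (fun i => if i == k%:Z then c i else 0)); last first.
  by move=> i _; apply: pihomog_poly_piece.
case: ifPn => ks.
  rewrite (bigD1_seq k%:Z) //= eqxx.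
  by rewrite big1 ?addr0 // => i /negPf->.
rewrite big_seq big1 // => i si; case: eqP => // ik.
by rewrite -ik si in ks.
Qed.

Lemma poly_piece_sum (v : S^o) : exists (s : seq int) (c : int -> S^o),
  [/\ uniq s, forall i, poly_piece i (c i) & v = \sum_(i <- s) c i].
Proof.
exists [seq Posz d | d <- iota 0 (mmeasure mdeg (v : S))],
  (fun i => if i is Posz d then pihomog mdeg d (v : S) else 0).
split.
- by rewrite map_inj_uniq ?iota_uniq // => a b [].
- by case=> d; [exact: pihomogP | exact: eqxx].
rewrite big_map -[X in iota 0 X]subn0 -/(index_iota _ _) big_mkord.
exact: pihomog_partitionE.
Qed.

Lemma poly_piece_direct (s : seq int) (c : int -> S^o) :
  uniq s -> (forall i, poly_piece i (c i)) -> \sum_(i <- s) c i = 0 ->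
  forall i, i \in s -> c i = 0.
Proof.
move=> us Pc s0 [] k ks; last by exact/eqP/(Pc (Negz k)).
by have := pihomog_piece_sum k us Pc; rewrite s0 pihomog0 ks.
Qed.

Definition poly_graded : gradedModule K m :=
  @GradedModule K m S^o poly_piece poly_piece0 poly_pieceB poly_pieceZ
    poly_piece_sum poly_piece_direct.

Lemma pihomogM_homog (d k : nat) (p g : S) : g \is d.-homog ->
  pihomog mdeg k (p * g) = if (d <= k)%N then pihomog mdeg (k - d) p * g else 0.
Proof.
move=> hg; pose N := maxn (mmeasure mdeg p) (k - d).+1.
rewrite {1}(@pihomog_partitionE _ _ mdeg N p) ?leq_maxl // mulr_suml raddf_sum /=.
have E (e : nat) : pihomog mdeg k (pihomog mdeg e p * g)
    = if (e + d == k)%N then pihomog mdeg e p * g else 0.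
  have hM := dhomogM (pihomogP mdeg e p) hg.
  by case: eqVneq hM => [->|ne] hM; [exact: pihomog_dE | exact: pihomog_ne0 hM].
rewrite (eq_bigr _ (fun (e : 'I_N) _ => E e)); case: leqP => [dk|kd].
  have kN : (k - d < N)%N by exact: leq_maxr.
  rewrite (bigD1 (Ordinal kN)) //= subnK // eqxx big1 ?addr0 // => e ne.
  case: eqP => // ek; case/eqP: ne; apply/val_inj => /=.
  by rewrite -ek addnK.
by rewrite big1 // => e _; case: eqP => // ek; rewrite -ek ltnNge leq_addl in kd.
Qed.

Lemma span_of_homogeneous (d : nat) (s : seq S^o) :
  (forall g : S, g \in s -> g \is d.-homog) ->
  homogeneous_submod (M := poly_graded) (span_of s).
Proof.
move=> hs t c ut Pc sc [] k kt; last by rewrite (eqP (Pc (Negz k))); exact: rpred0.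
have := pihomog_piece_sum k ut Pc; rewrite kt => <-.
move: sc => /asboolP[a ->]; rewrite raddf_sum /=.
apply: rpred_sum => j _.
have sj : s`_j \in s by exact: mem_nth.
rewrite [X in pihomog _ _ X](_ : _ = (a j : S) * (s`_j : S)) //.
rewrite (pihomogM_homog _ _ (hs _ sj)); case: ifP => _; last exact: rpred0.
apply: (@rpredZ _ _ (span_of s) _ s`_j); apply/asboolP.
exists (fun i => (i == j)%:R); rewrite (bigD1 j) //= eqxx scale1r big1 ?addr0 //.
by move=> i /negPf->; rewrite scale0r.
Qed.

End PolynomialRing.

Section StarGraph.
Variables (K : fieldType) (n : nat).

(* In {mpoly K[n.+1]}, x_(i+1) is 'X_(widen_ord (leqnSn n) i) and y is 'X_ord_max. *)
Definition star_gens : seq {mpoly K[n.+1]}^o :=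
  [seq ('X_(widen_ord (leqnSn n) i) * 'X_ord_max : {mpoly K[n.+1]}) | i : 'I_n].

Definition star_ideal : submodClosed (poly_graded K n.+1) :=
  span_of star_gens : submodClosed {mpoly K[n.+1]}^o.

Lemma star_ideal_homogeneous : homogeneous_submod star_ideal.
Proof.
apply: (@span_of_homogeneous K n.+1 2) => g /mapP[i _ ->].
by rewrite -mpolyXD dhomogX /= mdegD !mdeg1.
Qed.

Definition star_quotient : gradedModule K n.+1 :=
  graded_quotient star_ideal_homogeneous.

End StarGraph.

Section Constants.
Variable R : realType.

Definition B_of (eps : R) : R := ln ((2 * eps + 1) / (4 * eps)).

Definition A_of (eps : R) : int :=
  Num.ceil ((3 * B_of eps + 6) / (8 * eps) - (B_of eps + 1) / 2).

Lemma A_of_gt0 (eps : R) : 0 < eps -> eps < 1 / 2 -> 0 < A_of eps.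
Proof.
move=> e0 e1; have B0 : 0 <= B_of eps.
  by apply: ln_ge0; rewrite ler_pdivlMr; lra.
rewrite /A_of ceil_gt0 subr_gt0 ltr_pdivlMr; last by lra.
have Be : B_of eps * eps <= B_of eps * (1 / 2) by apply: ler_wpM2l => //; exact: ltW.
lra.
Qed.

End Constants.

(* Main.v *)
From HB Require Import structures.
Require Import Defs.
From mathcomp Require Import all_boot all_order all_algebra.
From mathcomp Require Import boolp classical_sets reals sequences exp.
From mathcomp Require Import mpoly.
From mathcomp Require Import zify lra ring.

(** Write [Delta h i = h i - h (i - 1)].  The heart of the proof is that a
    graded module [N] whose pieces have finite dimensions [h i], and which
    carries a regular sequence of length [d] in the irrelevant ideal, satisfies
    [(Delta^d h) i >= 0] for every [i] (lemma [hilbert_diff_ge0]).  In terms of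
    Hilbert series: [(1 - t)^d H_N(t)] has nonnegative coefficients.

    If the base field is infinite, one obtains this by dividing [N] by [d]
    general linear forms.  Here the field is arbitrary and the regular sequence
    need not be homogeneous, so a generic linear form is used, and its
    coefficients are kept as powers of an auxiliary variable [u] instead of
    being adjoined to the field.  Let [l = sum_i X_i u^i], acting from the
    polynomials of size at most [p] in [u] with coefficients in [N] to those of
    size at most [p + m]; this is a graded map [N^p(-1) -> N^(p + m)].
    McCoy's argument (lemma [generic_form_reflects]) shows that a congruence
    [l w = 0] modulo a submodule [T] forces [w = 0] modulo [T] as soon as some
    element of the irrelevant ideal is a nonzerodivisor modulo [T].  Applied
    with [T = (f_1, ..., f_j) N], this gives that [f_1, ..., f_(d-1)] is still
    regular on the cokernel of [l] (lemma [weakly_regular_generic_quotient]),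
    which is thus a graded module with a regular sequence of length [d - 1] and
    Hilbert function
    [(p + m) h i - p h (i - 1) = p (Delta h) i + m h i].
    By induction [p (Delta^d h) i + m (Delta^(d-1) h) i >= 0] for all [p], and
    letting [p] grow yields the claim.

    For the star graph, a monomial basis of the quotient gives Hilbert series
    [1/(1-t)^n + t/(1-t)].  Nonnegativity of its [d]-th difference in an even
    degree [k + 1] reads [C(d-1, k) <= C(k + n - d, k + 1)].  Taking [d = n] and
    [k = 1] shows that every regular sequence has length below [n].  Next
    suppose that some regular sequence is longer than the asserted bound, and
    take [d = ceil(n/2) + e] with [e = floor(eps n) + A - 1] and [k + 1] the
    even one of [e] and [e + 1].  With [c = n - d], the quotient of the two
    binomials is [(k+1)/c] times the product of the [(d-1-j)/(c+1+j)] for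
    [j < k]; each factor is at least [exp ((d-c-2-2j)/n)], so the inequality
    fails once [e exp (e (e-1)/n) > c].  The constant [A] is large enough for
    that: [e - 1/2 > eps n + (A - 5/2)] and the inequality between arithmetic
    and geometric means give [e (e-1)/n >= 4 eps (A - 5/2) - 1/8], which
    exceeds [ln (c/e)] when [eps < 1/4]; for larger [eps] one has [c < e] and
    nothing is left to prove (lemma [star_analytic_bound]).

    Since all regular sequences on all competing modules have bounded length,
    depths and the Hilbert depth exist as maxima of bounded nonempty sets. *)

Set Implicit Arguments.
Unset Strict Implicit.
Unset Printing Implicit Defensive.

Import Order.TTheory GRing.Theory Num.Theory.

Local Open Scope ring_scope.

(** * Dimensions of homogeneous pieces *)

Section Dimension.
Variables (K : fieldType) (m : nat).
Implicit Types M : gradedModule K m.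

Definition K_subspace M (P : set M) : Prop :=
  P 0 /\ forall (c : K) u v, P u -> P v -> P (c%:MP *: u + v).

Lemma K_subspace_sum M (P : set M) (I : finType) (c : I -> K) (b : I -> M) :
  K_subspace P -> (forall i, P (b i)) -> P (\sum_i (c i)%:MP *: b i).
Proof.
move=> [P0 PD] Pb.
by elim/big_rec: _ => // i u _ Pu; apply: PD.
Qed.

Lemma gpiece_subspace M i : K_subspace (gpiece (g := M) i).
Proof.
have Z (c : K) v : gpiece i v -> gpiece (g := M) i (c%:MP *: v).
  move=> Pv; rewrite -[i]add0r; apply: (gpieceZ (d := 0)) Pv.
  by rewrite -[c%:MP]mulr1 mul_mpolyC; apply: dhomogZ; exact: dhomog1.
split; first exact: gpiece0.
move=> c u v /Z Pu Pv; rewrite -[v]opprK; apply: gpieceB => //.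
by rewrite -[X in gpiece i X]sub0r; apply: gpieceB => //; exact: gpiece0.
Qed.

Lemma has_dim_fin M (P : set M) (I : finType) (b : I -> M) :
  (forall i, P (b i)) ->
  (forall v, P v -> exists c : I -> K, v = \sum_i (c i)%:MP *: b i) ->
  (forall c : I -> K, \sum_i (c i)%:MP *: b i = 0 -> forall i, c i = 0) ->
  has_dim P #|I|.
Proof.
move=> Pb span free; exists (fun j => b (enum_val j)); split=> //.
- move=> v /span[c ->]; exists (fun j => c (enum_val j)).
  by rewrite (reindex_onto enum_val enum_rank) /= => [|i _]; rewrite ?enum_rankK //;
     apply: eq_bigl => j; rewrite enum_valK eqxx.
- move=> c c0 j; have := free (fun i => c (enum_rank i)).
  rewrite (reindex_onto enum_val enum_rank) /= => [|i _]; last by rewrite enum_rankK.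
  under eq_bigl => k do rewrite enum_valK eqxx.
  under eq_bigr => k _ do rewrite enum_valK.
  by move=> /(_ c0 (enum_val j)); rewrite enum_valK.
Qed.

(** If the coefficient matrix of the free family on the spanning one had a
    nonzero row kernel, that kernel would be a linear relation. *)
Lemma free_le_spanning M (k l : nat) (b : 'I_k -> M) (s : 'I_l -> M) :
  (forall c : 'I_k -> K, \sum_j (c j)%:MP *: b j = 0 -> forall j, c j = 0) ->
  (forall j, exists c : 'I_l -> K, b j = \sum_i (c i)%:MP *: s i) ->
  (k <= l)%N.
Proof.
move=> free /choice[a aP]; pose A := \matrix_(j < k, i < l) a j i.
suff /eqP <- : row_free A by exact: rank_leq_col.
rewrite -kermx_eq0; apply/eqP/matrixP => r j; rewrite [RHS]mxE.
apply: (free (fun j => kermx A r j)).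
under eq_bigr => i _ do rewrite aP scaler_sumr.
rewrite exchange_big /= big1 // => i _.
under eq_bigr => i' _ do rewrite scalerA -mpolyCM.
rewrite -scaler_suml -raddf_sum /=.
have /matrixP/(_ r i) : kermx A *m A = 0 by exact: mulmx_ker.
rewrite !mxE => E; rewrite (_ : \sum_i _ = 0) ?raddf0 ?scale0r // -{}[RHS]E.
by apply: eq_bigr => i' _; rewrite !mxE.
Qed.

Lemma has_dim_uniq M (P : set M) k l : has_dim P k -> has_dim P l -> k = l.
Proof.
move=> [b [Pb sb fb]] [s [Ps ss fs]]; apply/eqP; rewrite eqn_leq.
rewrite (free_le_spanning fb (fun j => ss _ (Pb j))).
by rewrite (free_le_spanning fs (fun j => sb _ (Ps j))).
Qed.

Lemma hilbert_functionE M i k :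
  has_dim (gpiece (g := M) i) k -> hilbert_function M i = k.
Proof.
move=> dk; apply: (has_dim_uniq _ dk).
apply: (xgetPex 0%N (P := [set j | has_dim (gpiece (g := M) i) j])).
by exists k.
Qed.

(** A nontrivial relation expresses one vector by the others, which can then be
    dropped from the spanning family. *)
Lemma has_dim_spanning M (P : set M) (k : nat) (s : 'I_k -> M) :
  (forall j, P (s j)) ->
  (forall v, P v -> exists c : 'I_k -> K, v = \sum_j (c j)%:MP *: s j) ->
  exists l, has_dim P l.
Proof.
elim: k s => [s Ps span|k IH s Ps span].
  by exists 0%N, s; split=> // c _ [].
have [free|nfree] := pselect (forall c : 'I_k.+1 -> K,
    \sum_j (c j)%:MP *: s j = 0 -> forall j, c j = 0).
  by exists k.+1, s.
have [c [c0 [j0 cj0]]] : exists c : 'I_k.+1 -> K,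
    \sum_j (c j)%:MP *: s j = 0 /\ exists j, c j != 0.
  apply: contrapT => H; apply: nfree => c c0 j; apply: contrapT => cj.
  by apply: H; exists c; split=> //; exists j; apply/eqP.
pose t j := s (lift j0 j).
have sj0 : s j0 = \sum_j (- (c (lift j0 j) / c j0))%:MP *: t j.
  move: c0; rewrite (bigD1_ord j0) //= => /eqP; rewrite addr_eq0 => /eqP E.
  have -> : s j0 = ((c j0)^-1)%:MP *: ((c j0)%:MP *: s j0).
    by rewrite scalerA -mpolyCM mulVf // mpolyC1 scale1r.
  rewrite E scalerN scaler_sumr -sumrN; apply: eq_bigr => j _.
  by rewrite scalerA -mpolyCM -scaleNr -mpolyCN mulrC.
apply: (IH t) => [j|v /span[d ->]]; first exact: Ps.
exists (fun j => d j0 * (- (c (lift j0 j) / c j0)) + d (lift j0 j)).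
rewrite (bigD1_ord j0) //= {1}sj0 scaler_sumr -big_split /=.
by apply: eq_bigr => j _; rewrite scalerA -mpolyCM -scalerDl -mpolyCD.
Qed.

(** Rank-nullity: a basis of [U] in degree [i], together with lifts of a basis
    of the quotient, is a basis of the piece of [M]. *)
Lemma has_dim_quot M (U : submodClosed M) (homU : homogeneous_submod U) i a b :
  has_dim (gpiece (g := M) i) a ->
  has_dim [set v | gpiece (g := M) i v /\ v \in U] b ->
  exists c, has_dim (gpiece (g := graded_quotient homU) i) c /\ (b + c)%N = a.
Proof.
move=> da [u [Pu su fu]].
have piE (c : K) (v : M) : c%:MP *: quot_proj U v = quot_proj U (c%:MP *: v).
  exact: quot_scaleE.
have pis (k : nat) (c : 'I_k -> K) (w : 'I_k -> M) :
    \sum_j (c j)%:MP *: quot_proj U (w j) = quot_proj U (\sum_j (c j)%:MP *: w j).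
  rewrite (big_morph _ (@quot_projD _ _ U) (@quot_proj0 _ _ U)).
  by apply: eq_bigr => j _; rewrite piE.
have [c dc] : exists c, has_dim (gpiece (g := graded_quotient homU) i) c.
  have [w [Pw sw _]] := da.
  apply: (@has_dim_spanning _ _ a (fun j => quot_proj U (w j) : graded_quotient homU)).
    by move=> j; exists (w j).
  move=> _ [v /sw[d ->] <-]; exists d.
  by rewrite (pis _ d w).
exists c; split=> //.
have [w' [Pw' sw' fw']] := dc.
have /choice[w wP] j : exists v, gpiece i v /\ quot_proj U v = w' j.
  by have [v ? ?] := Pw' j; exists v.
pose e (x : 'I_b + 'I_c) := match x with inl j => u j | inr j => w j end.
suff de : has_dim (gpiece (g := M) i) #|{: 'I_b + 'I_c}|.
  by rewrite (has_dim_uniq da de) card_sum !card_ord.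
have big_e (d : 'I_b + 'I_c -> K) : \sum_x (d x)%:MP *: e x =
   \sum_j (d (inl j))%:MP *: u j + \sum_j (d (inr j))%:MP *: w j.
  by rewrite big_sumType.
have piw (d : 'I_c -> K) : quot_proj U (\sum_j (d j)%:MP *: w j) =
    \sum_j (d j)%:MP *: w' j.
  by rewrite -pis; apply: eq_bigr => j _; case: (wP j) => _ ->.
have piu (d : 'I_b -> K) : quot_proj U (\sum_j (d j)%:MP *: u j) = 0.
  by apply/quot_proj_eq0/rpred_sum => j _; apply: rpredZ; case: (Pu j).
have spanU v : gpiece i v -> v \in U -> exists d : 'I_b -> K, v = \sum_j (d j)%:MP *: u j.
  by move=> Pv Uv; apply: su.
apply: (has_dim_fin (b := e)).
- by case=> j /=; [case: (Pu j) | case: (wP j)].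
- move=> v Pv.
  have [|d dE] := sw' (quot_proj U v); first by exists v.
  have [||d' d'E] := spanU (v - \sum_j (d j)%:MP *: w j).
  + by apply: gpieceB => //; apply: K_subspace_sum (gpiece_subspace _ _) _ => j; case: (wP j).
  + by apply/quot_proj_eq0; rewrite quot_projB piw dE subrr.
  exists (fun x => match x with inl j => d' j | inr j => d j end).
  by rewrite big_e -d'E subrK.
- move=> d; rewrite big_e => d0.
  have d0r j : d (inr j) = 0.
    apply: (fw' (fun j => d (inr j))).
    have := congr1 (quot_proj U) d0.
    by rewrite quot_projD piu piw add0r quot_proj0.
  case=> j; last exact: d0r.
  apply: (fu (fun j => d (inl j))); move: d0.
  by rewrite [X in _ + X]big1 ?addr0 // => l _; rewrite d0r mpolyC0 scale0r.
Qed.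

End Dimension.

(** * Finitely generated modules have finite-dimensional pieces *)

Section FinitePieces.
Variables (K : fieldType) (m : nat).
Implicit Types M : gradedModule K m.

Lemma has_dim_spanning_fin M (P : set M) (I : finType) (b : I -> M) :
  (forall i, P (b i)) ->
  (forall v, P v -> exists c : I -> K, v = \sum_i (c i)%:MP *: b i) ->
  exists k, has_dim P k.
Proof.
move=> Pb span; apply: (has_dim_spanning (s := fun j => b (enum_val j))) => // v /span[c ->].
exists (fun j => c (enum_val j)).
by rewrite (reindex_onto enum_val enum_rank) /= => [|i _]; rewrite ?enum_rankK //;
   apply: eq_bigl => j; rewrite enum_valK eqxx.
Qed.

Lemma gpiece_sumP M i (I : finType) (A : pred I) (w : I -> M) :
  (forall a, A a -> gpiece i (w a)) -> gpiece i (\sum_(a | A a) w a).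
Proof.
move=> Pw; elim/big_rec: _ => [|a u Aa Pu]; first exact: gpiece0.
have [_ PD] := gpiece_subspace M i.
by rewrite -[w a]scale1r -[1]mpolyC1; apply: PD => //; apply: Pw.
Qed.

(** Directness of the grading, in the form in which it is used: the terms of a
    degree other than that of their sum cancel. *)
Lemma gpiece_component M (I : finType) (deg : I -> int) (w : I -> M) k v :
  gpiece k v -> (forall a, gpiece (deg a) (w a)) -> v = \sum_a w a ->
  v = \sum_(a | deg a == k) w a.
Proof.
move=> Pv Pw vE; pose t := undup (k :: [seq deg a | a <- enum I]).
pose c j := \sum_(a | deg a == j) w a - (if j == k then v else 0).
have ut : uniq t by exact: undup_uniq.
have kt : k \in t by rewrite mem_undup inE eqxx.
have degt a : deg a \in t.
  by rewrite mem_undup inE map_f ?orbT // mem_enum.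
have Pc j : gpiece j (c j).
  apply: gpieceB; first by apply: gpiece_sumP => a /eqP <-.
  by case: eqP => [->//|_]; exact: gpiece0.
have c0 : \sum_(j <- t) c j = 0.
  have sum1 (F : int -> M) j : j \in t -> \sum_(l <- t | l == j) F l = F j.
    by move=> jt; rewrite -big_filter filter_pred1_uniq // big_seq1.
  rewrite sumrB (exchange_big_dep xpredT) //= -big_mkcond sum1 //.
  rewrite [X in _ - X]vE -sumrB big1 // => a _.
  by under eq_bigl => j do rewrite eq_sym; rewrite sum1 ?subrr.
have /eqP := gpiece_direct ut Pc c0 kt.
by rewrite /c eqxx subr_eq0 => /eqP.
Qed.

Lemma gpiece_sum_family M q (v : 'I_q -> M) : exists (s : seq int) (c : 'I_q -> int -> M),
  [/\ uniq s, forall k i, gpiece i (c k i) & forall k, v k = \sum_(i <- s) c k i].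
Proof.
have /choice[t /choice[e teP]] k : exists t : seq int, exists e : int -> M,
    [/\ uniq t, forall i, gpiece i (e i) & v k = \sum_(i <- t) e i].
  exact: gpiece_sum.
exists (undup (flatten [seq t k | k <- enum 'I_q])),
  (fun k i => if i \in t k then e k i else 0).
split=> [|k i|k]; first exact: undup_uniq.
  by case: ifP => _; [case: (teP k) | exact: gpiece0].
have [ut _ ->] := teP k.
rewrite -big_mkcond -big_filter; apply: perm_big; apply: uniq_perm => //.
  by rewrite filter_uniq // undup_uniq.
move=> i; rewrite mem_filter mem_undup; case: (boolP (i \in t k)) => //= ik.
by apply/esym/flattenP; exists (t k) => //; rewrite map_f // mem_enum.
Qed.

Lemma homogeneous_generators M : finitely_generated M ->
  exists (I : finType) (g : I -> M) (d : I -> int),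
    (forall r, gpiece (d r) (g r)) /\
    forall v, exists p : I -> {mpoly K[m]}, v = \sum_r p r *: g r.
Proof.
move=> [s sP]; have [t [e [_ Pe sE]]] := gpiece_sum_family (fun j : 'I_(size s) => s`_j).
exists ('I_(size s) * 'I_(size t))%type, (fun x => e x.1 t`_(val x.2)),
  (fun x => t`_(val x.2)).
split=> [x|v]; first exact: Pe.
have /asboolP[c ->] := sP v; exists (fun x => c x.1).
rewrite -(pair_bigA _ (fun j (r : 'I_(size t)) => c j *: e j t`_r)) /=.
apply: eq_bigr => j _; rewrite -scaler_sumr sE.
by rewrite (big_nth 0 xpredT) big_mkord.
Qed.

(** Only finitely many products of a monomial and a homogeneous generator have
    degree [i], and by [gpiece_component] they span the piece. *)
Lemma finitely_generated_has_dim M i :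
  finitely_generated M -> exists k, has_dim (gpiece (g := M) i) k.
Proof.
move=> /homogeneous_generators[I [g [d [Pg gspan]]]].
pose D := (\sum_r `|i - d r|).+1%N.
have dD r (mu : 'X_{1..m}) : (mdeg mu)%:Z + d r = i -> (mdeg mu < D)%N.
  move=> E; have -> : mdeg mu = `|i - d r|%N by rewrite -E addrK.
  by rewrite ltnS (bigD1 r) //= leq_addr.
pose b (x : I * 'X_{1..m < D}) : M :=
  if (mdeg x.2)%:Z + d x.1 == i then 'X_[x.2] *: g x.1 else 0.
apply: (has_dim_spanning_fin (b := b)) => [x|v Pv].
  rewrite /b; case: eqP => [<-|_]; last exact: gpiece0.
  by apply: gpieceZ => //; rewrite dhomogX /=.
pose Q (u : M) := exists c : I * 'X_{1..m < D} -> K, u = \sum_x (c x)%:MP *: b x.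
have Q0 : Q 0 by exists (fun=> 0); rewrite big1 // => x _; rewrite mpolyC0 scale0r.
have QD u u' : Q u -> Q u' -> Q (u + u').
  move=> [c ->] [c' ->]; exists (fun x => c x + c' x); rewrite -big_split /=.
  by apply: eq_bigr => x _; rewrite mpolyCD scalerDl.
have Qb c x : Q (c%:MP *: b x).
  exists (fun y => if y == x then c else 0); rewrite (bigD1 x) //= eqxx big1 ?addr0 //.
  by move=> y /negPf->; rewrite mpolyC0 scale0r.
have [p pE] := gspan v.
pose E := \max_r msize (p r).
have vE : v = \sum_(x : I * 'X_{1..m < E}) ((p x.1)@_(x.2) *: 'X_[x.2]) *: g x.1.
  rewrite pE -(pair_bigA _ (fun r (mu : 'X_{1..m < E}) => ((p r)@_mu *: 'X_[mu]) *: g r)) /=.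
  apply: eq_bigr => r _; rewrite -scaler_suml -mpolywE //.
  by rewrite /E; apply: leq_bigmax.
rewrite (gpiece_component (deg := fun x : I * 'X_{1..m < E} => (mdeg x.2)%:Z + d x.1) Pv _ vE); last first.
  by move=> x; apply: gpieceZ => //; rewrite dhomogZ // dhomogX.
suff : Q (\sum_(x : I * 'X_{1..m < E} | (mdeg x.2)%:Z + d x.1 == i)
            ((p x.1)@_(x.2) *: 'X_[x.2]) *: g x.1) by [].
elim/big_rec: _ => // -[r mu] u /= /eqP Emu Qu; apply: QD => //.
have := Qb (p r)@_mu (r, BMultinom (dD _ _ Emu)).
by rewrite /b /= Emu eqxx scalerA mul_mpolyC.
Qed.

End FinitePieces.

(** * Exchanging a regular sequence for a generic linear form *)

Section IdealMultiples.
Variables (R : comNzRingType).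
Implicit Types V : lmodType R.

(** Coefficients indexed by [nat] make it possible to compare the sequences
    [f] and [take i f]. *)
Lemma in_ideal_mulP V (f : seq R) (v : V) :
  in_ideal_mul f v <-> exists w : nat -> V, v = \sum_(j < size f) f`_j *: w j.
Proof.
split=> [[w ->]|[w ->]]; last by exists (fun j => w j).
exists (fun j => if insub j is Some j' then w j' else 0).
by apply: eq_bigr => j _; rewrite valK.
Qed.

Lemma in_ideal_mul0 V (f : seq R) : in_ideal_mul f (0 : V).
Proof. by exists (fun=> 0); rewrite big1 // => j _; rewrite scaler0. Qed.

Lemma in_ideal_mulD V (f : seq R) (u v : V) :
  in_ideal_mul f u -> in_ideal_mul f v -> in_ideal_mul f (u + v).
Proof.
move=> [a ->] [b ->]; exists (fun j => a j + b j).
by rewrite -big_split; apply: eq_bigr => j _; rewrite scalerDr.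
Qed.

Lemma in_ideal_mulZ V (f : seq R) a (v : V) :
  in_ideal_mul f v -> in_ideal_mul f (a *: v).
Proof.
move=> [b ->]; exists (fun j => a *: b j); rewrite scaler_sumr.
by apply: eq_bigr => j _; rewrite !scalerA mulrC.
Qed.

Lemma in_ideal_mul_takeS V (f : seq R) i (v : V) : (i < size f)%N ->
  in_ideal_mul (take i.+1 f) v <->
  exists u w, in_ideal_mul (take i f) u /\ v = u + f`_i *: w.
Proof.
move=> lt_i; have sz : size (take i f) = i by rewrite size_takel // ltnW.
have nthE (j : 'I_i) : (rcons (take i f) f`_i)`_j = (take i f)`_j.
  by rewrite nth_rcons sz ltn_ord.
rewrite (take_nth 0) //; split.
  move=> /in_ideal_mulP[w]; rewrite size_rcons sz big_ord_recr /= => ->.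
  exists (\sum_(j < i) (take i f)`_j *: w j), (w i); split.
    by apply/in_ideal_mulP; exists w; rewrite sz.
  by rewrite nth_rcons sz ltnn eqxx; under eq_bigr => j _ do rewrite nthE.
move=> [u [w [/in_ideal_mulP[a]]]]; rewrite sz => -> ->.
apply/in_ideal_mulP; exists (fun j => if j == i then w else a j).
rewrite size_rcons sz big_ord_recr /= nth_rcons sz ltnn !eqxx; congr (_ + _).
by apply: eq_bigr => j _; rewrite nthE ltn_eqF.
Qed.

Lemma in_ideal_mul_ffun V (I : finType) (f : seq R) (v : {ffun I -> V}) :
  in_ideal_mul f v <-> forall k, in_ideal_mul f (v k).
Proof.
split=> [[w ->] k|/choice[w wP]].
  by exists (fun j => w j k); rewrite sum_ffunE; apply: eq_bigr => j _; rewrite ffunE.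
exists (fun j => [ffun k => w k j]); apply/ffunP => k.
by rewrite sum_ffunE wP; apply: eq_bigr => j _; rewrite !ffunE.
Qed.

Lemma in_ideal_mul_quot V (U : submodClosed V) (f : seq R) (v : V) :
  in_ideal_mul f (quot_proj U v) <-> exists2 u, u \in U & in_ideal_mul f (v + u).
Proof.
have piS (w : 'I_(size f) -> V) : \sum_(j < size f) f`_j *: quot_proj U (w j) =
    quot_proj U (\sum_(j < size f) f`_j *: w j).
  rewrite (big_morph _ (@quot_projD _ _ U) (@quot_proj0 _ _ U)).
  by apply: eq_bigr => j _; exact: quot_scaleE.
split=> [[w' E]|[u Uu [w E]]].
  have /choice[w wP] j := quot_proj_surj (w' j).
  exists (\sum_(j < size f) f`_j *: w j - v); last by exists w; rewrite addrC subrK.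
  apply/quot_proj_eq0; rewrite quot_projB -piS E.
  by rewrite -sumrB big1 // => j _; rewrite wP subrr.
exists (fun j => quot_proj U (w j)); rewrite piS -E quot_projD.
by have /quot_proj_eq0 -> := Uu; rewrite addr0.
Qed.

(** The nonzerodivisor conditions of [regular_sequence] alone: they pass to
    initial segments and, by [weakly_regular_generic_quotient], to cokernels of
    generic forms. *)
Definition weakly_regular V (f : seq R) : Prop :=
  forall i : nat, (i < size f)%N -> forall v : V,
    in_ideal_mul (take i f) (f`_i *: v) -> in_ideal_mul (take i f) v.

Lemma weakly_regular_take V (f : seq R) d :
  weakly_regular V f -> weakly_regular V (take d f).
Proof.
move=> fr i; rewrite size_take_min leq_min => /andP[id isz] v.
by rewrite nth_take // take_takel 1?ltnW //; exact: fr.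
Qed.

End IdealMultiples.

Section GenericLinearForm.
Variables (K : fieldType) (m : nat).
Local Notation S := {mpoly K[m]}.
Variables (V : lmodType S) (p : nat).

(** Multiplication by the linear form [sum_i X_i u^i], where a finite function
    stands for the sequence of coefficients of a polynomial in [u]. *)
Definition generic_form (w : {ffun 'I_p -> V}) : {ffun 'I_(p + m) -> V} :=
  [ffun k : 'I_(p + m) =>
     \sum_(i < m) \sum_(j < p | (i + j)%N == k) 'X_i *: w j].

Lemma generic_form_is_linear : linear generic_form.
Proof.
move=> a u v; apply/ffunP => k; rewrite !ffunE scaler_sumr -big_split /=.
apply: eq_bigr => i _; rewrite scaler_sumr -big_split /=.
by apply: eq_bigr => j _; rewrite !ffunE scalerDr !scalerA mulrC.
Qed.

HB.instance Definition _ := GRing.isLinear.Build S {ffun 'I_p -> V}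
  {ffun 'I_(p + m) -> V} _ generic_form generic_form_is_linear.

(** McCoy's argument.  Induct on a bound [s] beyond which the coefficients of
    [w] lie in [T].  The coefficient of index [i + s] of the product, with [i]
    decreasing, shows that ['X_i *: w s] lies in [T]; then ['X_i *: w] has the
    smaller bound [s - 1] and so lies in [T].  As all [X_i] carry [w] into [T],
    so does [f]. *)
Lemma generic_form_reflects (T : V -> Prop) (f : S) (w : {ffun 'I_p -> V}) :
  T 0 -> (forall u v, T u -> T v -> T (u + v)) -> (forall a v, T v -> T (a *: v)) ->
  f \in irrelevant_ideal (K := K) (m := m) -> (forall v, T (f *: v) -> T v) ->
  (forall k, T (generic_form w k)) -> forall j, T (w j).
Proof.
move=> T0 TD TZ f_irr fT.
have Tsum (I : finType) (A : pred I) (F : I -> V) :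
    (forall i, A i -> T (F i)) -> T (\sum_(i | A i) F i).
  by move=> TF; elim/big_rec: _ => // i u Ai Tu; apply: TD => //; exact: TF.
have T_X v : (forall i, T ('X_i *: v)) -> T v.
  move=> TX; apply: fT; move: f_irr => /asboolP[c ->].
  rewrite scaler_suml; apply: Tsum => j _.
  set s := [seq _ | _ : _] in j c *.
  have /mapP[i _ ->] : s`_j \in s by exact: mem_nth.
  by rewrite -scalerA; apply: TZ.
suff main s : forall w : {ffun 'I_p -> V}, (forall k, T (generic_form w k)) ->
    (forall j : 'I_p, (s <= j)%N -> T (w j)) -> forall j, T (w j).
  by move=> Tw; apply: (main p) => // j; rewrite leqNgt ltn_ord.
elim: s => [|s IHs] {}w Tw Ts; first by move=> j; exact: Ts.
have [ps|sp] := leqP p s.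
  by apply: IHs => // j sj; have := leq_trans (ltn_ord j) ps; rewrite ltnNge sj.
suff TX i : forall j, T ('X_i *: w j) by move=> j; apply: T_X.
have [r] := ubnP (m - i)%N; elim: r i => // r IHr i; rewrite ltnS => ri.
suff Tis : T ('X_i *: w (Ordinal sp)).
  move=> j; have := IHs ('X_i *: w) _ _ j; rewrite ffunE; apply.
    by move=> k; rewrite linearZ ffunE; apply: TZ.
  move=> l; rewrite leq_eqVlt ffunE => /predU1P[sl|sl].
    by rewrite (_ : l = Ordinal sp) //; apply: val_inj.
  by apply: TZ; exact: Ts.
have ltk : (i + s < p + m)%N by rewrite addnC -addSn leq_add // ltnW.
have := Tw (Ordinal ltk); rewrite ffunE (bigD1 i) //=.
rewrite (big_pred1 (Ordinal sp)) => [|j]; last by rewrite /= eqn_add2l.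
set rest := \sum_(_ < _ | _) _; suff Trest : T rest.
  by move=> TT; rewrite -[X in T X](addrK rest); apply: TD => //; rewrite -scaleN1r; apply: TZ.
apply: (Tsum) => i' ne_i; apply: (Tsum) => j /eqP ij.
have [lt_i|] := ltnP i i'.
  by apply: IHr; have := ltn_ord i'; lia.
rewrite leq_eqVlt (negPf (ne_i : val i' != val i)) /= => lt_i.
by apply: TZ; apply: Ts; lia.
Qed.

Lemma in_ideal_mul_generic_form (f : seq S) (w : {ffun 'I_p -> V}) :
  in_ideal_mul f w -> in_ideal_mul f (generic_form w).
Proof.
move=> [b ->]; exists (fun j => generic_form (b j)).
by rewrite linear_sum; apply: eq_bigr => j _; rewrite linearZ.
Qed.

Definition generic_form_image_pred : {pred {ffun 'I_(p + m) -> V}} :=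
  [pred v | `[< exists w, v = generic_form w >]].

Lemma generic_form_image_submod : submod_closed generic_form_image_pred.
Proof.
split=> [|a u v /asboolP[w ->] /asboolP[w' ->]]; apply/asboolP.
  by exists 0; rewrite linear0.
by exists (a *: w + w'); rewrite linearP.
Qed.

HB.instance Definition _ :=
  GRing.isSubmodClosed.Build S {ffun 'I_(p + m) -> V}
    generic_form_image_pred generic_form_image_submod.

Definition generic_form_image : submodClosed {ffun 'I_(p + m) -> V} :=
  generic_form_image_pred.

(** Let [f_i v + l w] lie in [J = (f_0, ..., f_(i-1))].  Modulo
    [(f_0, ..., f_i)], on which [f_(i+1)] acts injectively, [l w] vanishes, hence
    so does [w], say [w = u + f_i w'] with [u] in [J].  Then
    [f_i (v + l w')] lies in [J], and therefore [v + l w'] does.  The last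
    element of [f] is lost because the step for [f_i] uses [f_(i+1)]. *)
Lemma weakly_regular_generic_quotient (f : seq S) (d : nat) :
  size f = d.+1 -> {subset f <= irrelevant_ideal (K := K) (m := m)} ->
  weakly_regular V f -> weakly_regular (quot_mod generic_form_image) (take d f).
Proof.
move=> szf f_irr f_reg i; rewrite size_takel ?szf // => id x.
have [v ->] := quot_proj_surj x.
rewrite nth_take // take_takel 1?ltnW //.
have -> : f`_i *: quot_proj generic_form_image v
        = quot_proj generic_form_image (f`_i *: v) by exact: quot_scaleE.
move=> /in_ideal_mul_quot[_ /asboolP[w ->]].
have isz : (i < size f)%N by rewrite szf ltnW.
set J := take i f => Jfv.
have w_in : in_ideal_mul (take i.+1 f) w.
  apply/in_ideal_mul_ffun; apply: (generic_form_reflects (f := f`_i.+1)).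
  - exact: in_ideal_mul0.
  - exact: in_ideal_mulD.
  - exact: in_ideal_mulZ.
  - by apply/f_irr/mem_nth; rewrite szf.
  - by move=> u; apply: f_reg; rewrite szf.
  move=> k; apply/in_ideal_mul_takeS => //.
  move/in_ideal_mul_ffun: Jfv => /(_ k); rewrite ffunE [(_ *: v) k]ffunE => Jfv.
  exists (f`_i *: v k + generic_form w k), (- v k); split=> //.
  by rewrite [X in _ + X]scalerN addrAC subrr add0r.
move/(in_ideal_mul_takeS _ isz): w_in => [u [w' [Ju wE]]].
apply/in_ideal_mul_quot; exists (generic_form w'); first by apply/asboolP; exists w'.
apply/in_ideal_mul_ffun => k; apply: (f_reg i isz).
have /in_ideal_mul_ffun/(_ k) : in_ideal_mul J (f`_i *: (v + generic_form w')).
  rewrite (_ : _ *: _ = f`_i *: v + generic_form w - generic_form u).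
    by apply: in_ideal_mulD => //; rewrite -scaleN1r; apply/in_ideal_mulZ/in_ideal_mul_generic_form.
  by rewrite wE [u + _]addrC generic_form_is_linear scalerDr addrA addrK.
by rewrite ffunE.
Qed.

End GenericLinearForm.

(** * Regular sequences force nonnegative differences of the Hilbert function *)

Section GradedPower.
Variables (K : fieldType) (m : nat) (M : gradedModule K m).

Variable q : nat.

Definition power_piece (i : int) : set {ffun 'I_q -> M} :=
  [set v | forall k, gpiece i (v k)].

Lemma power_piece0 i : power_piece i 0.
Proof. by move=> k; rewrite ffunE; exact: gpiece0. Qed.

Lemma power_pieceB i u v :
  power_piece i u -> power_piece i v -> power_piece i (u - v).
Proof. by move=> Pu Pv k; rewrite !ffunE; apply: gpieceB. Qed.

Lemma power_pieceZ (d : nat) (i : int) (p : {mpoly K[m]}) v :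
  p \is d.-homog -> power_piece i v -> power_piece (d%:Z + i) (p *: v).
Proof. by move=> hp Pv k; rewrite ffunE; apply: gpieceZ. Qed.

Lemma power_piece_sum v : exists (s : seq int) (c : int -> {ffun 'I_q -> M}),
  [/\ uniq s, forall i, power_piece i (c i) & v = \sum_(i <- s) c i].
Proof.
have [s [c [us Pc vE]]] := gpiece_sum_family v.
exists s, (fun i => [ffun k => c k i]); split=> // [i k|]; first by rewrite ffunE.
by apply/ffunP => k; rewrite sum_ffunE vE; apply: eq_bigr => i _; rewrite ffunE.
Qed.

Lemma power_piece_direct (s : seq int) (c : int -> {ffun 'I_q -> M}) :
  uniq s -> (forall i, power_piece i (c i)) -> \sum_(i <- s) c i = 0 ->
  forall i, i \in s -> c i = 0.
Proof.
move=> us Pc c0 i si; apply/ffunP => k; rewrite ffunE.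
apply: (gpiece_direct (c := fun i => c i k) us _ _ si) => [j|]; first exact: Pc.
by rewrite -sum_ffunE c0 ffunE.
Qed.

Definition power_graded : gradedModule K m :=
  GradedModule power_piece0 power_pieceB power_pieceZ power_piece_sum power_piece_direct.

Lemma has_dim_power i h : has_dim (gpiece (g := M) i) h ->
  has_dim (gpiece (g := power_graded) i) (q * h).
Proof.
move=> [b [Pb sb fb]].
pose e (x : 'I_q * 'I_h) : power_graded := [ffun k => if k == x.1 then b x.2 else 0].
have eE (c : 'I_q * 'I_h -> K) k :
    (\sum_x (c x)%:MP *: e x : {ffun 'I_q -> M}) k = \sum_j (c (k, j))%:MP *: b j.
  rewrite sum_ffunE.
  rewrite (eq_bigr (fun x => (fun k' j => (c (k', j))%:MP *: e (k', j) k) x.1 x.2)); last first.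
    by move=> [k' j] _; rewrite ffunE.
  rewrite -(pair_bigA _ (fun k' j => (c (k', j))%:MP *: e (k', j) k)) /=.
  rewrite (bigD1 k) //= [X in _ + X]big1 ?addr0; last first.
    move=> k' /negPf ne; rewrite big1 // => j _.
    by rewrite !ffunE /= eq_sym ne scaler0.
  by apply: eq_bigr => j _; rewrite !ffunE /= eqxx.
rewrite (_ : (q * h)%N = #|{: 'I_q * 'I_h}|); last by rewrite card_prod !card_ord.
apply: (has_dim_fin (b := e)).
- by move=> [k j] k'; rewrite ffunE; case: eqP => _ //; exact: gpiece0.
- move=> v Pv; have /choice[c cP] k : exists c : 'I_h -> K, v k = \sum_j (c j)%:MP *: b j.
    exact/sb/Pv.
  exists (fun x => c x.1 x.2); apply/ffunP => k.
  by rewrite cP; apply/esym; apply: eE.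
move=> c c0 [k j]; apply: (fb (fun j => c (k, j))).
by rewrite -eE c0 ffunE.
Qed.

End GradedPower.

Section GenericQuotient.
Variables (K : fieldType) (m : nat).

Lemma homogeneous_submod_decomp (M : gradedModule K m) (U : submodClosed M) :
  (forall u, u \in U -> exists (s : seq int) (c : int -> M),
     [/\ forall i, gpiece i (c i), forall i, c i \in U & u = \sum_(i <- s) c i]) ->
  homogeneous_submod U.
Proof.
move=> dec s c us Pc /dec[t [e [Pe Ue E]]] k ks.
pose w (x : 'I_(size t) + 'I_(size s)) := match x with
  | inl r => e t`_r | inr r => if s`_r == k then 0 else - c s`_r end.
pose deg (x : 'I_(size t) + 'I_(size s)) := match x with
  | inl r => t`_r | inr r => s`_r end.
have Pw x : gpiece (deg x) (w x).
  case: x => r //=; case: ifP => _; first exact: gpiece0.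
  by rewrite -sub0r; apply: gpieceB => //; exact: gpiece0.
have ckE : c k = \sum_x w x.
  rewrite big_sumType /= -(big_mkord xpredT (fun r => e t`_r)) -(big_nth 0 xpredT).
  rewrite -E -(big_mkord xpredT (fun r => if s`_r == k then 0 else - c s`_r)).
  rewrite -(big_nth 0 xpredT (fun i => if i == k then 0 else - c i)) -big_split /=.
  rewrite (bigD1_seq k) //= eqxx addr0 big1 ?addr0 // => i /negPf ->.
  by rewrite subrr.
rewrite (gpiece_component (Pc k) Pw ckE); apply: rpred_sum => -[r|r] /= /eqP rk //.
by rewrite rk eqxx; exact: rpred0.
Qed.

Variables (M : gradedModule K m) (p : nat).
Local Notation form := (@generic_form K m M p).
Local Notation image := (generic_form_image M p).

Lemma generic_form_piece i w : gpiece (g := power_graded M p) i w ->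
  gpiece (g := power_graded M (p + m)) (1 + i) (form w).
Proof.
move=> Pw k; rewrite ffunE; apply: gpiece_sumP => r _; apply: gpiece_sumP => j _.
by apply: gpieceZ => //; rewrite dhomogX /= mdeg1.
Qed.

Lemma generic_form_sum (I : Type) (s : seq I) (P : pred I) F :
  form (\sum_(i <- s | P i) F i) = \sum_(i <- s | P i) form (F i).
Proof. exact: linear_sum. Qed.

Lemma generic_form_homogeneous :
  homogeneous_submod (M := power_graded M (p + m)) image.
Proof.
apply: (@homogeneous_submod_decomp (power_graded M (p + m)) image).
move=> _ /asboolP[w ->].
have [s [c [us Pc ->]]] := gpiece_sum (g := power_graded M p) w.
exists [seq 1 + i | i <- s], (fun i => form (c (i - 1))); split.
- by move=> i; have := generic_form_piece (Pc (i - 1)); rewrite addrC subrK.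
- by move=> i; apply/asboolP; eexists.
rewrite generic_form_sum big_map; apply: eq_bigr => i _.
by rewrite addrC addKr.
Qed.

Definition generic_quotient : gradedModule K m :=
  graded_quotient generic_form_homogeneous.

(** The degree [i] part of the image is isomorphic to the degree [i - 1] part
    of [N^p], whence the Hilbert function of the cokernel. *)
Hypothesis form_inj : forall w, form w = 0 -> w = 0.

Lemma has_dim_generic_image i h : has_dim (gpiece (g := M) (i - 1)) h ->
  has_dim [set v | gpiece (g := power_graded M (p + m)) i v /\ v \in image] (p * h).
Proof.
move=> /(@has_dim_power _ _ _ p)[b [Pb sb fb]].
have i1 : i = 1 + (i - 1) by rewrite addrC subrK.
have formS (c : 'I_(p * h) -> K) : form (\sum_j (c j)%:MP *: b j)
    = \sum_j (c j)%:MP *: form (b j).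
  by rewrite generic_form_sum; apply: eq_bigr => j _; rewrite linearZ.
exists (fun j => form (b j)); split.
- move=> j; split; first by rewrite i1; exact: generic_form_piece.
  by apply/asboolP; exists (b j).
- move=> v [Pv /asboolP[w wE]].
  have [s [c [us Pc wS]]] := gpiece_sum (g := power_graded M p) w.
  have vE : v = \sum_(r < size s) form (c s`_r).
    rewrite wE wS generic_form_sum.
    by rewrite (big_nth 0 xpredT) big_mkord.
  have := gpiece_component (deg := fun r : 'I_(size s) => 1 + s`_r) Pv _ vE.
  have Pfc r : gpiece (g := power_graded M (p + m)) (1 + s`_r) (form (c s`_r)).
    exact: generic_form_piece.
  move=> /(_ Pfc); rewrite -generic_form_sum => ->.
  have [|d ->] := sb (\sum_(r < size s | 1 + s`_r == i) c s`_r).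
    by apply: gpiece_sumP => r /eqP <-; rewrite addrC addKr.
  by exists d; rewrite formS.
- by move=> c; rewrite -formS => /form_inj; exact: fb.
Qed.

Lemma has_dim_generic_quotient i h h' :
  has_dim (gpiece (g := M) i) h -> has_dim (gpiece (g := M) (i - 1)) h' ->
  exists c, has_dim (gpiece (g := generic_quotient) i) c /\
    (p * h' + c)%N = ((p + m) * h)%N.
Proof.
move=> /(@has_dim_power _ _ _ (p + m)) dh /has_dim_generic_image dh'.
exact: has_dim_quot dh dh'.
Qed.

End GenericQuotient.

Section Differences.

Definition backward_diff (h : int -> int) (i : int) : int := h i - h (i - 1).

Lemma backward_diff_iter_comb d (a b : int) (h g : int -> int) i :
  iter d backward_diff (fun j => a * h j + b * g j) i
  = a * iter d backward_diff h i + b * iter d backward_diff g i.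
Proof.
elim: d i => //= d IH i; rewrite {1}/backward_diff !IH /backward_diff.
by rewrite !mulrBr opprD addrACA.
Qed.

End Differences.

(** The limit in the number [p] of coefficients. *)
Lemma eventually_nonneg (a b : int) : (forall p : nat, 0 <= p%:Z * a + b) -> 0 <= a.
Proof.
move=> H; rewrite leNgt; apply/negP => a0.
have := H `|b|.+1%N; nia.
Qed.

Section Positivity.
Variables (K : fieldType) (m : nat).

(** The cokernel of the generic form has Hilbert function [p (Delta h) + m h]
    and a regular sequence shorter by one, so the induction hypothesis bounds
    [p (Delta^(d+1) h) + m (Delta^d h)] from below by [0] for every [p]. *)
Lemma hilbert_diff_ge0 (f : seq {mpoly K[m]}) (M : gradedModule K m) (h : int -> nat) :
  {subset f <= irrelevant_ideal (K := K) (m := m)} -> weakly_regular M f ->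
  (forall i, has_dim (gpiece (g := M) i) (h i)) ->
  forall i, 0 <= iter (size f) backward_diff (fun j => (h j)%:Z) i.
Proof.
have [d szf] : exists d, size f = d by exists (size f).
rewrite szf; elim: d => [|d IH] in f szf M h *; first by [].
move=> f_irr f_reg dh i.
apply: (@eventually_nonneg _ (m%:Z * iter d backward_diff (fun j => (h j)%:Z) i)) => p.
(* The first element of [f] is a nonzerodivisor on [M]: take [T = 0]. *)
have form_inj w : @generic_form K m M p w = 0 -> w = 0.
  move=> w0; apply/ffunP => j; rewrite ffunE.
  apply: (generic_form_reflects (T := fun v => v = 0) (f := f`_0)) => //.
  - by move=> u v -> ->; rewrite addr0.
  - by move=> a v ->; rewrite scaler0.
  - by apply/f_irr/mem_nth; rewrite szf.
  - move=> v v0; have f_gt0 : (0 < size f)%N by rewrite szf.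
    have [|w' ->] := f_reg 0%N f_gt0 v.
      by rewrite v0; exact: in_ideal_mul0.
    by apply: big1 => -[j' H] _; exfalso; move: H; rewrite take0.
  - by move=> k; rewrite w0 ffunE.
have /choice[c cP] j := has_dim_generic_quotient form_inj (dh j) (dh (j - 1)).
have := IH (take d f) _ (generic_quotient M p) c.
rewrite size_takel ?szf // => /(_ erefl) H.
have {H} := H _ _ (fun j => proj1 (cP j)) i.
have -> : (fun j => (c j)%:Z) =
    fun j => p%:Z * backward_diff (fun j => (h j)%:Z) j + m%:Z * (h j)%:Z.
  apply/funext => j; have [_] := cP j; rewrite /backward_diff; lia.
rewrite backward_diff_iter_comb -iterSr; apply.
  by move=> g /mem_take; exact: f_irr.
exact: weakly_regular_generic_quotient.
Qed.

End Positivity.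

(** * The Hilbert function of the star graph quotient *)

Section StarHilbert.
Variables (K : fieldType) (n : nat).
Local Notation S := {mpoly K[n.+1]}.
Local Notation x_ i := (widen_ord (leqnSn n) i).

(** The monomials outside the star ideal: those in the [x_i] alone, and the
    powers of [y]. *)
Definition off_star (mu : 'X_{1..n.+1}) : bool :=
  (mu ord_max == 0%N) || [forall i : 'I_n, mu (x_ i) == 0%N].

Lemma star_ideal_coeff (v : S) mu : v \in star_ideal K n -> off_star mu -> v@_mu = 0.
Proof.
move=> /asboolP[c ->] off; rewrite raddf_sum big1 //= => j _.
have /mapP[i _ ->] : (star_gens K n)`_j \in star_gens K n by exact: mem_nth.
rewrite -mpolyXD [_ *: _]/(c j * _).
apply: memN_msupp_eq0; rewrite (perm_mem (msuppMX _ _)).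
apply/mapP => -[mu' _ E]; case/orP: off => [|/forallP/(_ i)].
  by rewrite E !mnmDE !mnm1E eqxx !addn_eq0 andbF.
by rewrite E !mnmDE !mnm1E eqxx !addn_eq0.
Qed.

Lemma star_ideal_monomial mu : ~~ off_star mu -> ('X_[mu] : S) \in star_ideal K n.
Proof.
rewrite negb_or negb_forall => /andP[y_mu /existsP[i x_mu]].
pose g : S := 'X_(x_ i) * 'X_ord_max.
have -> : 'X_[mu] = 'X_[mu - (U_(x_ i) + U_(ord_max))] * g :> S.
  rewrite /g -!mpolyXD submK //; apply/mnm_lepP => j; rewrite mnmDE !mnm1E.
  case: (eqVneq (x_ i) j) => [<-|_]; last by case: eqVneq => [<-|]; rewrite ?lt0n.
  by rewrite (_ : (ord_max == x_ i) = false) ?addn0 ?lt0n // -val_eqE /= gtn_eqF.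
have gS : (g : S^o) \in star_gens K n by apply: map_f; rewrite mem_enum.
apply: (@rpredZ S S^o (star_ideal K n) 'X_[_] (g : S^o)).
have /(nthP 0)[r rs rE] := gS.
apply/asboolP; exists (fun j => (val j == r)%:R); rewrite (bigD1 (Ordinal rs)) //= eqxx scale1r rE.
rewrite big1 ?addr0 // => j ne; case: eqP => E; last by rewrite scale0r.
by case/eqP: ne; apply: val_inj.
Qed.

(** In degree [0] the only power of [y] is [1], already a monomial in the
    [x_i]; this is what the length [0 < k] of the second list accounts for. *)
Definition off_star_monomials (k : nat) : seq 'X_{1..n.+1} :=
  [seq mnmwiden (s2m t) | t : k.-tuple 'I_n <- enum (basis n k)]
  ++ nseq (0 < k)%N (U_(ord_max) *+ k)%MM.

Lemma off_star_monomialsP k mu :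
  (mu \in off_star_monomials k) = (mdeg mu == k) && off_star mu.
Proof.
have degE : mdeg mu = (\sum_(i < n) mu (x_ i) + mu ord_max)%N.
  by rewrite mdegE big_ord_recr.
rewrite /off_star_monomials mem_cat; apply/idP/idP.
  case/orP=> [/mapP[t]|].
    rewrite mem_enum => tb E; rewrite degE /off_star E mnmwiden_ordmax eqxx addn0 andbT.
    under eq_bigr => i _ do rewrite mnmwiden_widen.
    by rewrite -mdegE basis_cover; apply/mapP; exists t; rewrite ?mem_enum.
  case: ltngtP => //= k0; rewrite inE => /eqP E.
  have xE i : mu (x_ i) = 0%N.
    by rewrite E mulmnE mnm1E -val_eqE /= gtn_eqF.
  rewrite degE big1 => [|i _]; last exact: xE.
  rewrite /off_star E mulmnE mnm1E eqxx mul1n add0n eqxx /= -E.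
  by apply/orP; right; apply/forallP => i; rewrite xE.
case/andP => /eqP dk; have [y0 _|y0] := eqVneq (mu ord_max) 0%N.
  pose mu' := [multinom mu (x_ i) | i < n].
  have E : mu = mnmwiden mu'.
    apply/mnmP => j; case: (unliftP ord_max j) => [i ->|->]; last by rewrite mnmwiden_ordmax.
    rewrite (_ : lift ord_max i = x_ i); first by rewrite mnmwiden_widen mnmE.
    by apply: val_inj; rewrite /= /bump leqNgt ltn_ord.
  have : mdeg mu' == k.
    by rewrite -dk degE y0 addn0 mdegE; apply/eqP/eq_bigr => i _; rewrite mnmE.
  rewrite basis_cover => /mapP[t tb tE]; apply/orP; left.
  by apply/mapP; exists t => //; rewrite E tE.
rewrite /off_star (negPf y0) => /forallP /= x0; apply/orP; right.
have yk : mu ord_max = k.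
  by rewrite -dk degE big1 // => i _; apply/eqP/x0.
rewrite -{1}yk lt0n y0 inE; apply/eqP/mnmP => j; rewrite mulmnE mnm1E.
case: (unliftP ord_max j) => [i ->|->]; last by rewrite eqxx mul1n.
rewrite (negPf (neq_lift _ _)) mul0n; apply/eqP.
rewrite (_ : lift ord_max i = x_ i) ?x0 //.
by apply: val_inj; rewrite /= /bump leqNgt ltn_ord.
Qed.

Lemma off_star_monomials_uniq k : uniq (off_star_monomials k).
Proof.
rewrite cat_uniq (map_comp (@mnmwiden n)) map_inj_uniq ?uniq_basis; last exact: inj_mnmwiden.
case: ltnP => k0 //=; rewrite orbF andbT.
apply/mapP => -[mu _ /mnmP/(_ ord_max)].
by rewrite mnmwiden_ordmax mulmnE mnm1E eqxx mul1n => E; rewrite E in k0.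
Qed.

Lemma size_off_star_monomials k : (0 < n)%N ->
  size (off_star_monomials k) = ('C(k + n.-1, k) + (0 < k))%N.
Proof.
have sz n' : (0 < n')%N -> size (enum (basis n' k)) = 'C(k + n'.-1, k).
  by case: n' => // n' _; rewrite -(size_basis n' k) size_map.
by move=> n0; rewrite size_cat size_nseq size_map sz.
Qed.

Lemma has_dim_star_quotient (k : nat) : (0 < n)%N ->
  has_dim (gpiece (g := star_quotient K n) k) ('C(k + n.-1, k) + (0 < k)).
Proof.
move=> n0; rewrite -size_off_star_monomials //.
set b := off_star_monomials k; pose pi (v : S) : star_quotient K n := quot_proj (star_ideal K n) v.
have piS (c : 'I_(size b) -> K) :
    \sum_j (c j)%:MP *: pi 'X_[nth 0%MM b j] = pi (\sum_j c j *: 'X_[nth 0%MM b j]).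
  rewrite [RHS](big_morph _ (@quot_projD _ _ _) (@quot_proj0 _ _ _)).
  by apply: eq_bigr => j _; rewrite -mul_mpolyC; exact: quot_scaleE.
have coeffb (c : 'I_(size b) -> K) (j : 'I_(size b)) :
    (\sum_i c i *: 'X_[nth 0%MM b i])@_(nth 0%MM b j) = c j.
  rewrite raddf_sum (bigD1 j) //= mcoeffZ mcoeffX eqxx mulr1 big1 ?addr0 // => i ne.
  by rewrite mcoeffZ mcoeffX nth_uniq ?off_star_monomials_uniq // (negPf (ne : val i != val j)) mulr0.
have offb (j : 'I_(size b)) : (mdeg (nth 0%MM b j) == k) && off_star (nth 0%MM b j).
  by rewrite -off_star_monomialsP; apply: mem_nth.
exists (fun j => pi 'X_[nth 0%MM b j]); split.
- move=> j; exists ('X_[nth 0%MM b j] : S^o) => //=.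
  by rewrite dhomogX; case/andP: (offb j).
- move=> _ [v /= hv <-]; exists (fun j => v@_(nth 0%MM b j)); rewrite piS.
  apply/eqP; rewrite -subr_eq0 -quot_projB; apply/eqP/quot_proj_eq0.
  set r := _ - _; have hr : (r : S) \is k.-homog.
    apply: rpredB => //; apply: rpred_sum => j _; apply: rpredZ.
    by rewrite dhomogX; case/andP: (offb j).
  rewrite [r]mpolyE; apply: rpred_sum => mu _.
  have [/(nthP 0%MM)[i ib <-]|mu_b] := boolP (mu \in b).
    by rewrite /r mcoeffB (coeffb _ (Ordinal ib)) subrr scale0r; exact: rpred0.
  have [mu_k|mu_k] := eqVneq (mdeg mu) k; last first.
    by rewrite (dhomog_nemf_coeff hr) // scale0r; exact: rpred0.
  rewrite -mul_mpolyC; apply: (@rpredZ S S^o (star_ideal K n) _ ('X_[mu] : S)).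
  by apply: star_ideal_monomial; move: mu_b; rewrite off_star_monomialsP mu_k eqxx.
- move=> c; rewrite piS => /quot_proj_eq0 cI j.
  by rewrite -(coeffb c j); apply: star_ideal_coeff cI _; case/andP: (offb j).
Qed.

Lemma has_dim_star_quotient_neg (k : nat) :
  has_dim (gpiece (g := star_quotient K n) (Negz k)) 0.
Proof.
exists (fun=> 0); split=> [j|_ [v /= /eqP -> <-]|c _ []] //; first exact: gpiece0.
by exists (fun=> 0); rewrite big_ord0; exact: quot_proj0.
Qed.

Definition star_hilbert (i : int) : nat :=
  if i is Posz k then ('C(k + n.-1, k) + (0 < k))%N else 0%N.

Lemma star_quotient_hilbert i : (0 < n)%N ->
  has_dim (gpiece (g := star_quotient K n) i) (star_hilbert i).
Proof.
by case: i => k n0; [exact: has_dim_star_quotient | exact: has_dim_star_quotient_neg].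
Qed.

Lemma star_quotient_fg : finitely_generated (star_quotient K n).
Proof.
exists [:: quot_proj (star_ideal K n) (1 : S) : star_quotient K n] => x.
have [v ->] := quot_proj_surj x; apply/asboolP; exists (fun=> v).
rewrite big_ord1 /=.
have -> : v *: (quot_proj (star_ideal K n) (1 : S) : star_quotient K n)
   = quot_proj (star_ideal K n) (v *: (1 : S^o)) by exact: quot_scaleE.
by rewrite [v *: _]mulr1.
Qed.

End StarHilbert.

Section StarDifferences.

(** Differencing [1/(1-t)^(r+d)] down to [1/(1-t)^r].  The coefficient is
    written with [(k + r).-1] rather than [k + r.-1], so that it is that of the
    constant series [1] when [r = 0]. *)
Lemma backward_diff_iter_binomial (r d : nat) (i : int) :
  iter d backward_diff (fun j : int => if j is Posz k then 'C((k + (r + d)).-1, k)%:Z else 0) i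
  = if i is Posz k then 'C((k + r).-1, k)%:Z else 0.
Proof.
elim: d r i => [|d IH] r i; first by rewrite addn0.
rewrite -addSnnS iterS /backward_diff !IH; case: i => [[|k]|k] //=.
  by rewrite subr0 !bin0.
by rewrite subn1 /= addnS binS PoszD addrK.
Qed.

(** The powers of [y] contribute [t (1-t)^d] after [d + 1] differences. *)
Lemma backward_diff_iter_tail (d : nat) (i : int) :
  iter d.+1 backward_diff (fun j : int => if j is Posz k.+1 then 1 else 0) i
  = if i is Posz k.+1 then (-1) ^+ k * 'C(d, k)%:Z else 0.
Proof.
elim: d i => [|d IH] i.
  rewrite /= /backward_diff; case: i => [[|[|k]]|k] //=.
  by rewrite subrr bin0n mulr0.
rewrite iterS /backward_diff !IH; case: i => [[|[|k]]|k] //=.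
  by rewrite !bin0 subr0.
by rewrite exprS binS PoszD; ring.
Qed.

Lemma star_hilbert_diff (n d k : nat) : (0 < d <= n)%N ->
  iter d backward_diff (fun j => (star_hilbert n j)%:Z) k.+1%:Z
  = 'C(k + (n - d), k.+1)%:Z + (-1) ^+ k * 'C(d.-1, k)%:Z.
Proof.
case: d => // d dn.
pose poly (j : int) : int :=
  if j is Posz k then 'C((k + (n - d.+1 + d.+1)).-1, k)%:Z else 0.
pose tail (j : int) : int := if j is Posz k.+1 then 1 else 0.
have -> : (fun j => (star_hilbert n j)%:Z) = fun j => 1 * poly j + 1 * tail j.
  apply/funext => -[[|j]|j] //=; rewrite subnK // ?bin0 //.
  by rewrite !mul1r PoszD (_ : j.+1 + n.-1 = j + n)%N //; lia.
by rewrite backward_diff_iter_comb !mul1r backward_diff_iter_binomial backward_diff_iter_tail.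
Qed.

End StarDifferences.

(** * Estimates on binomial coefficients and on the constants *)

Section Numerics.
Variable R : realType.

(** From [exp (-x) >= 1 - x] at [x = (a-b)/(a+b) <= 1 - b/a]. *)
Lemma expR_ratio_le (a b : nat) : (0 < b <= a)%N ->
  b%:R * expR ((a%:R - b%:R) / (a + b)%:R) <= a%:R :> R.
Proof.
case/andP => b0 ba; have br : 0 < b%:R :> R by rewrite ltr0n.
have bar : b%:R <= a%:R :> R by rewrite ler_nat.
have ar : 0 < a%:R :> R by lra.
set x := _ / _; have xle : x <= 1 - b%:R / a%:R.
  rewrite /x natrD ler_pdivrMr; last by lra.
  rewrite mulrBl mul1r mulrDr divfK ?gt_eqF //.
  have : 0 <= b%:R / a%:R * (a%:R - b%:R) :> R by rewrite mulr_ge0 ?divr_ge0; lra.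
  rewrite mulrBr divfK ?gt_eqF //; lra.
have := expR_ge1Dx (- x); rewrite expRN => ex.
have : b%:R / a%:R <= (expR x)^-1 by lra.
by rewrite ler_pdivrMr // mulrC ler_pdivlMr ?expR_gt0.
Qed.

(** Clearing factorials, compare [c] times the product of the [c + 1 + j] with
    [k + 1] times the product of the [d - 1 - j].  Factors of the same index have
    sum [c + d], so each pair gains [exp ((d - c - 2 - 2j)/(c + d))]; these
    exponents add up to [k (d - c - k - 1)/(c + d)]. *)
Lemma bin_lt_expR (c d k : nat) : (0 < c)%N -> (k.*2 + c <= d)%N ->
  c%:R < k.+1%:R * expR (k%:R * (d%:R - c%:R - k.+1%:R) / (c + d)%:R) :> R ->
  ('C(k + c, k.+1) < 'C(d.-1, k))%N.
Proof.
move=> c0 kd lt_c.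
have prodE : expR (k%:R * (d%:R - c%:R - k.+1%:R) / (c + d)%:R) =
    \prod_(j < k) expR (((d.-1 - j)%N%:R - (c + j.+1)%N%:R) / (c + d)%:R) :> R.
  rewrite -expR_sum -mulr_suml; congr (expR (_ / _)).
  have dE j : (j <= k)%N -> (d.-1 - j)%N%:R = d%:R - 1 - j%:R :> R.
    by move=> jk; rewrite natrB; [rewrite -subn1 natrB//|]; lia.
  rewrite (eq_bigr (fun j : 'I_k => d%:R - c%:R - 2 - 2 * j%:R)); last first.
    by move=> j _; rewrite dE 1?ltnW // natrD -[j.+1]addn1 natrD; lra.
  rewrite -[k in LHS]/(0 + k)%N; clear; elim: k => [|k IH]; first by rewrite big_ord0 mul0r.
  by rewrite big_ord_recr /= -IH -[k.+2]addn1 -[k.+1]addn1 !natrD; ring.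
suff : (c * \prod_(j < k) (c + j.+1) < k.+1 * \prod_(j < k) (d.-1 - j))%N.
  have -> : (c * \prod_(j < k) (c + j.+1) = 'C(k + c, k.+1) * k.+1`!)%N.
    rewrite bin_ffact ffact_prod big_ord_recr (reindex_inj rev_ord_inj) /= mulnC.
    congr (_ * _)%N; last by lia.
    by apply: eq_bigr => j _; have := ltn_ord j; lia.
  by rewrite -ffact_prod -bin_ffact factS mulnCA ltn_pmul2l // ltn_pmul2r ?fact_gt0.
rewrite -(ltr_nat R) !natrM !natr_prod.
have b_gt0 : 0 < \prod_(j < k) (c + j.+1)%N%:R :> R.
  by apply: prodr_gt0 => j _; rewrite ltr0n addnS.
have : \prod_(j < k) (c + j.+1)%N%:R * expR (k%:R * (d%:R - c%:R - k.+1%:R) / (c + d)%:R)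
    <= \prod_(j < k) (d.-1 - j)%N%:R :> R.
  rewrite prodE -big_split /=; apply: ler_prod => j _.
  have jk := ltn_ord j; rewrite mulr_ge0 ?expR_ge0 //=.
  rewrite (_ : (c + d = (d.-1 - j) + (c + j.+1))%N); last by lia.
  by apply: expR_ratio_le; lia.
move=> le_prod; have : 0 < k.+1%:R :> R by rewrite ltr0n.
nra.
Qed.

Lemma A_of_ge (eps : R) :
  (3 * B_of eps + 6) / (8 * eps) - (B_of eps + 1) / 2 <= (A_of eps)%:~R.
Proof. exact: ceil_ge. Qed.

Lemma B_of_ge0 (eps : R) : 0 < eps -> eps < 1 / 2 -> 0 <= B_of eps.
Proof. by move=> e0 e1; apply: ln_ge0; rewrite ler_pdivlMr; lra. Qed.

Lemma A_of_ge2 (eps : R) : 0 < eps -> eps < 1 / 2 -> 2 <= A_of eps.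
Proof.
move=> e0 e1; have B0 := B_of_ge0 e0 e1; have A0 := A_of_ge eps.
suff : 1%:~R < (A_of eps)%:~R :> R by rewrite ltr_int.
apply: lt_le_trans A0; rewrite ltrBrDr ltr_pdivlMr; last by lra.
have Be : B_of eps * eps <= B_of eps * (1 / 2) by apply: ler_wpM2l => //; exact: ltW.
lra.
Qed.

(** If [eps >= 1/4] then already [c < e].  Otherwise [c/e] is below
    [(1 - 2 eps)/(2 eps)], which equals [exp B * (1 + w)] for
    [w = (1 - 6 eps)/(1 + 2 eps)].  As [1 + w <= exp w], it suffices to prove
    [B + w <= e (e-1)/n]. *)
Lemma star_analytic_bound (eps : R) (n c e : nat) :
  0 < eps -> eps < 1 / 2 -> (2 <= n)%N ->
  eps * n%:R + (A_of eps)%:~R - 2 < e%:R -> ((c + e).*2 <= n)%N ->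
  c%:R < e%:R * expR (e%:R * (e%:R - 1) / n%:R) :> R.
Proof.
move=> e0 e1 n2 lt_e; rewrite -(ler_nat R) -mul2n natrM natrD => le_n.
have A2 : 2 <= (A_of eps)%:~R :> R by rewrite -[2]/(2%:~R) ler_int A_of_ge2.
have nr : 2 <= n%:R :> R by rewrite ler_nat.
have en0 : 0 < eps * n%:R by rewrite mulr_gt0 //; lra.
have er : 0 < e%:R :> R by lra.
have e_ge1 : 1 <= e%:R :> R by rewrite ler1n -(ltr_nat R).
set Y := _ / _; have Y0 : 0 <= Y by rewrite /Y divr_ge0 ?mulr_ge0; lra.
have expY1 : 1 <= expR Y by apply: le_trans (expR_ge1Dx Y); lra.
have [eps14|eps14] := leP (1 / 4) eps.
  have : n%:R <= eps * n%:R * 4 by rewrite -mulrA mulrC -mulrA ler_peMr; lra.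
  nra.
set B := B_of eps; have B0 : 0 <= B by exact: B_of_ge0.
have expB : expR B = (2 * eps + 1) / (4 * eps).
  by rewrite lnK // posrE divr_gt0; lra.
have Age := A_of_ge eps; rewrite -/B in Age.
set A := (A_of eps)%:~R in Age A2 lt_e.
have A8 : 3 * B + 6 <= (A + (B + 1) / 2) * (8 * eps).
  by rewrite -ler_pdivrMr; lra.
pose w := (1 - 6 * eps) / (1 + 2 * eps).
have wE : w * (1 + 2 * eps) = 1 - 6 * eps by rewrite divfK // gt_eqF; lra.
suff YB : B + w <= Y.
  have : expR (B + w) <= expR Y by rewrite ler_expR.
  rewrite expRD expB => eY.
  have ew : 1 + w <= expR w by exact: expR_ge1Dx.
  have eq1 : (2 * eps + 1) / (4 * eps) * (1 + w) = (1 - 2 * eps) / (2 * eps).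
    by rewrite /w; field; rewrite !gt_eqF //; lra.
  have : (1 - 2 * eps) / (2 * eps) <= expR Y.
    apply: le_trans eY; rewrite -eq1 ler_pM2l // divr_gt0; lra.
  rewrite ler_pdivrMr; last by lra.
  have : c%:R * (2 * eps) < e%:R * (1 - 2 * eps) by nra.
  nra.
have w_le : w <= 3 - 12 * eps - 1 / 8.
  by rewrite /w ler_pdivrMr; nra.
rewrite /Y ler_pdivlMr; last by lra.
have [t tE] : exists t, t = A - 5 / 2 by eexists.
have t8 : B + 3 - 12 * eps <= 4 * eps * t by rewrite tE; nra.
have t0 : 0 <= t by rewrite -(pmulr_rge0 (x := 4 * eps)); lra.
(* [e (e-1) = (e - 1/2)^2 - 1/4], and [e - 1/2 > eps n + t]. *)
have g2 : (eps * n%:R + t) ^+ 2 <= (e%:R - 1 / 2) ^+ 2.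
  by apply: lerXn2r; rewrite ?nnegrE; lra.
have amgm : 4 * (eps * n%:R) * t <= (eps * n%:R + t) ^+ 2 
  by have := sqr_ge0 (eps * n%:R - t); nra.
have : (B + 3 - 12 * eps) * n%:R <= 4 * eps * t * n%:R by rewrite ler_wpM2r; lra.
nra.
Qed.
End Numerics.

(** * The Hilbert depth of the star graph quotient *)

Section HilbertDepthExists.
Variables (K : fieldType) (m : nat).
Implicit Types M N : gradedModule K m.

Lemma bounded_nat_max (P : nat -> Prop) b :
  (exists k, P k) -> (forall k, P k -> (k <= b)%N) ->
  exists k, P k /\ forall l, P l -> (l <= k)%N.
Proof.
move=> [k0 Pk0] Pb.
have ex : exists k, `[< P k >] by exists k0; apply/asboolP.
have bd k : `[< P k >] -> (k <= b)%N by move/asboolP/Pb.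
case: (ex_maxnP ex bd) => k /asboolP Pk max; exists k; split=> // l Pl.
by apply: max; apply/asboolP.
Qed.

(** The depths of [M] and the Hilbert depth are maxima of bounded sets of
    lengths; the empty sequence is regular on the nonzero module [M], and [M]
    itself competes for the Hilbert depth. *)
Lemma is_hdepth_exists M b : finitely_generated M -> (exists v : M, v <> 0) ->
  (forall N (f : seq {mpoly K[m]}), finitely_generated N -> same_hilbert_series N M ->
     {subset f <= irrelevant_ideal (K := K) (m := m)} -> weakly_regular N f ->
     (size f <= b)%N) ->
  exists h, is_hdepth M h /\ (h <= b)%N.
Proof.
move=> Mfg [v v0] bound.
have depth_le N d : finitely_generated N -> same_hilbert_series N M -> is_depth N d ->
    (d <= b)%N.
  by move=> Nfg NM [[f [<- f_irr [f_reg _]]] _]; exact: bound f_reg.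
pose lengths l := exists f : seq {mpoly K[m]},
  [/\ size f = l, {subset f <= irrelevant_ideal (K := K) (m := m)} & regular_sequence M f].
have [||d [[f fP] dmax]] := @bounded_nat_max lengths b.
- exists 0%N, [::]; split=> //; split=> //; exists v => -[w]; rewrite big_ord0.
  exact: v0.
- by move=> _ [f [<- f_irr [f_reg _]]]; exact: bound f_reg.
have Md : is_depth M d.
  by split=> [|g g_irr g_reg]; [exists f | apply: dmax; exists g].
have [||h [[N [Nfg NM Nh]] hmax]] := @bounded_nat_max
  (fun k => exists N, [/\ finitely_generated N, same_hilbert_series N M & is_depth N k]) b.
- by exists d, M.
- by move=> k [N [Nfg NM Nk]]; exact: depth_le Nk.
exists h; split; last exact: depth_le Nh.
by split=> [|N' k N'fg N'M N'k]; [exists N | apply: hmax; exists N'].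
Qed.

End HilbertDepthExists.

Section StarDepth.
Variables (K : fieldType) (n : nat) (N : gradedModule K n.+1) (f : seq {mpoly K[n.+1]}).
Hypothesis n_gt0 : (0 < n)%N.
Hypothesis N_fg : finitely_generated N.
Hypothesis N_star : same_hilbert_series N (star_quotient K n).
Hypothesis f_irr : {subset f <= irrelevant_ideal (K := K) (m := n.+1)}.
Hypothesis f_reg : weakly_regular N f.

(** An odd [k] makes the contribution of the powers of [y] negative. *)
Lemma star_regular_bin d k : (0 < d <= n)%N -> (d <= size f)%N -> odd k ->
  ('C(d.-1, k) <= 'C(k + (n - d), k.+1))%N.
Proof.
move=> dn df k_odd.
have dimN i : has_dim (gpiece (g := N) i) (star_hilbert n i).
  have [h dh] := finitely_generated_has_dim i N_fg.
  have := hilbert_functionE dh.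
  by rewrite N_star (hilbert_functionE (star_quotient_hilbert K i n_gt0)) => ->.
have take_irr : {subset take d f <= irrelevant_ideal (K := K) (m := n.+1)}.
  by move=> g /mem_take; exact: f_irr.
have := hilbert_diff_ge0 take_irr (weakly_regular_take f_reg) dimN k.+1.
by rewrite size_takel // star_hilbert_diff // -signr_odd k_odd expr1 mulN1r subr_ge0.
Qed.

(** At [d = n] and [k = 1] the inequality reads [n - 1 <= 0]. *)
Lemma star_regular_size_lt : (1 < n)%N -> (size f < n)%N.
Proof.
move=> n1; rewrite ltnNge; apply/negP => nf.
have := @star_regular_bin n 1 _ nf erefl.
by rewrite subnn bin1 bin_small // n_gt0 leqnn => /(_ isT); lia.
Qed.

End StarDepth.

Lemma star_quotient_neq0 (K : fieldType) n : exists v : star_quotient K n, v <> 0.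
Proof.
exists (quot_proj (star_ideal K n) (1 : {mpoly K[n.+1]})) => /quot_proj_eq0.
move=> /(@star_ideal_coeff _ _ _ 0%MM); rewrite mcoeff1 eqxx /off_star mnm0E => /(_ isT).
by move/eqP; rewrite oner_eq0.
Qed.

(** A sequence exceeding the bound would have a regular initial part of length
    [d = ceil(n/2) + e], contradicting [star_regular_bin] at the odd [k] among
    [e - 1] and [e].  Both choices satisfy [e (e-1) <= k (2d - n - k - 1)], since
    [2d - n >= 2e]. *)
Lemma star_regular_size_bound (K : fieldType) (R : realType) (eps : R) (n : nat)
    (N : gradedModule K n.+1) (f : seq {mpoly K[n.+1]}) :
  0 < eps -> eps < 1 / 2 -> (2 <= n)%N ->
  finitely_generated N -> same_hilbert_series N (star_quotient K n) ->
  {subset f <= irrelevant_ideal (K := K) (m := n.+1)} -> weakly_regular N f ->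
  (size f)%:Z <= Num.ceil (n%:R / 2 : R) + Num.floor (eps * n%:R) + A_of eps - 2.
Proof.
move=> e0 e1 n2 Nfg NM f_irr f_reg.
have n0 : (0 < n)%N by lia.
have size_lt := star_regular_size_lt n0 Nfg NM f_irr f_reg n2.
have A2 := A_of_ge2 e0 e1.
have fl0 : 0 <= Num.floor (eps * n%:R) by rewrite floor_ge0 mulr_ge0 ?ler0n // ltW.
have [z [zE zle zge]] : exists z : nat, [/\ Num.ceil (n%:R / 2 : R) = z%:Z,
    (z.*2 <= n.+1)%N & (n <= z.*2)%N].
  exists (uphalf n); split; try lia.
  have [le_n lt_n] : (n <= (uphalf n).*2)%N /\ ((uphalf n).*2 < n.+2)%N by lia.
  move: le_n lt_n; rewrite -(ler_nat R) -(ltr_nat R) -mul2n -[n.+2]addn2 natrM natrD => le_n lt_n.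
  apply/eqP; rewrite eq_le ceil_le_int -[Posz _](subrK 1) -ltzD1 ltrD2r ceil_gt_int.
  rewrite rmorphB /=; apply/andP; split; lra.
rewrite zE leNgt; apply/negP => lt_size.
have [e eE] : exists e : nat, e%:Z = Num.floor (eps * n%:R) + A_of eps - 1.
  by exists `|(Num.floor (eps * n%:R) + A_of eps - 1)%R|%N; lia.
have er : eps * n%:R + (A_of eps)%:~R - 2 < e%:R.
  have /andP[_ lt_fl] := floor_itv (eps * n%:R).
  rewrite -[e%:R]/(e%:Z%:~R) eE; move: lt_fl; rewrite rmorphB !rmorphD /=; lra.
pose k := if odd e then e else e.-1.
pose d := (z + e)%N.
have dn : (0 < d <= n)%N by rewrite /d; lia.
have k_odd : odd k by rewrite /k; case: ifP => //; lia.
have [ke ek] : (k <= e)%N /\ (e <= k.+1)%N by rewrite /k; case: ifP; lia.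
have d_size : (d <= size f)%N by rewrite /d; lia.
have bin_le := star_regular_bin n0 Nfg NM f_irr f_reg dn d_size k_odd.
suff : ('C(k + (n - d), k.+1) < 'C(d.-1, k))%N by rewrite ltnNge bin_le.
apply: (@bin_lt_expR R); [by rewrite /d; lia| by rewrite /d; lia|].
have c_lt : (n - d)%:R < e%:R * expR (e%:R * (e%:R - 1) / n%:R) :> R.
  by apply: star_analytic_bound e0 e1 n2 er _; rewrite /d; lia.
have nE : n%:R = (n - d)%:R + d%:R :> R by rewrite -natrD subnK //; lia.
apply: lt_le_trans c_lt _; apply: ler_pM; rewrite ?ler_nat ?expR_ge0 //.
rewrite ler_expR subnK; last by lia.
rewrite ler_wpM2r ?invr_ge0 //.
have gap : (n - d)%:R + 2 * e%:R <= d%:R :> R.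
  by rewrite -natrM -natrD ler_nat /d; lia.
have kr0 : 0 <= k%:R :> R by [].
have [keE|keE] : k%:R = e%:R :> R \/ e%:R = k%:R + 1 :> R.
- rewrite /k; case: ifP => odd_e; [by left|right].
  by rewrite natr1 prednK //; lia.
- by rewrite -natr1 keE ler_wpM2l //; lra.
- by rewrite -natr1 keE mulrC addrK ler_wpM2l //; lra.
Qed.

Theorem theorem2p6 (K : fieldType) (R : realType) (eps : R)
    (eps_gt0 : 0 < eps) (eps_lt : eps < 1 / 2) (n : nat) (n_ge2 : (2 <= n)%N) :
  exists h : nat, is_hdepth (star_quotient K n) h /\
    h%:Z <= Num.ceil (n%:R / 2 : R) + Num.floor (eps * n%:R) + A_of eps - 2.
Proof.
set bound := _ - 2.
have size_le (N : gradedModule K n.+1) (f : seq {mpoly K[n.+1]}) :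
    finitely_generated N -> same_hilbert_series N (star_quotient K n) ->
    {subset f <= irrelevant_ideal (K := K) (m := n.+1)} -> weakly_regular N f ->
    (size f <= `|bound|)%N.
  by move=> Nfg NM f_irr /(star_regular_size_bound eps_gt0 eps_lt n_ge2 Nfg NM f_irr); rewrite -/bound; lia.
have bound_ge0 : 0 <= bound.
  have : weakly_regular (star_quotient K n) [::] by [].
  by move/(star_regular_size_bound eps_gt0 eps_lt n_ge2 (star_quotient_fg K n)); apply.
have [h [hP h_le]] := is_hdepth_exists (star_quotient_fg K n) (star_quotient_neq0 K n) size_le.
by exists h; split=> //; lia.
Qed.
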